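(* Let $A\in\mathbb{C}^{q\times n}$, let $W\in\mathbb{C}^{n\times q}$ be nonzero, let $m$ be a positive integer and let $k=\max\{\mathrm{Ind}(AW),\mathrm{Ind}(WA)\}$. Then: (1) $A^{\mathrm{wg}_m,W,\dag}\in A\{2\}$; (2) $\mathrm{rank}(A^{\mathrm{wg}_m,W,\dag})=\mathrm{rank}(WA^{D,W})=\mathrm{rank}((WA)^{k})$; (3) $\mathcal{R}(A^{\mathrm{wg}_m,W,\dag})=\mathcal{R}(WA^{D,W})=\mathcal{R}((WA)^{k})$; (4) $\mathcal{N}(A^{\mathrm{wg}_m,W,\dag})=\mathcal{N}(A^{\mathrm{cEP},W}(WA)^{m+1}A^{\dag})=\mathcal{N}(((WA)^k)^*(WA)^{m+1}A^{\dag})$; (5) $A^{\mathrm{wg}_m,W,\dag}=A^{(2)}_{\mathcal{R}(WA^{D,W}),\,\mathcal{N}(A^{\mathrm{cEP},W}(WA)^{m+1}A^{\dag})}=A^{(2)}_{\mathcal{R}((WA)^{k}),\,\mathcal{N}(((WA)^k)^*(WA)^{m+1}A^{\dag})}$.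
   Context: $M^{\dag}$, $M^*$, $\mathcal{R}(M)$, $\mathcal{N}(M)$ are the Moore-Penrose inverse, conjugate transpose, range and null space of a complex matrix $M$. For square $M$: $M^0=I$, $\mathrm{Ind}(M)$ is the smallest nonnegative integer $k$ with $\mathrm{rank}(M^k)=\mathrm{rank}(M^{k+1})$; $M^D$ is the Drazin inverse; the core-EP inverse $M^{\mathrm{cEP}}$ is the unique $X$ with $XMX=X$ and $\mathcal{R}(X)=\mathcal{R}(X^* )=\mathcal{R}(M^{\mathrm{Ind}(M)})$. For $X,Y\in\mathbb{C}^{q\times n}$ the $W$-product is $X\star Y=XWY$, and $X^{\star l}$ is the $l$-fold $W$-product of $X$ with itself. The $W$-weighted Drazin inverse is $A^{D,W}=A((WA)^D)^2$; the weighted core-EP inverse is $A^{\mathrm{cEP},W}=A((WA)^{\mathrm{cEP}})^2$; the $W$-weighted $m$-weak group inverse is $A^{\mathrm{wg}_m,W}=(A^{\mathrm{cEP},W})^{\star(m+1)}WA^{\star m}\in\mathbb{C}^{q\times n}$. The $W$-weighted $m$-weak group MP inverse ($W$-$m$-WGMP inverse) is $A^{\mathrm{wg}_m,W,\dag}=WA^{\mathrm{wg}_m,W}WAA^{\dag}\in\mathbb{C}^{n\times q}$. $A\{2\}=\{X\in\mathbb{C}^{n\times q}\mid XAX=X\}$, and $A^{(2)}_{\mathcal{T},\mathcal{S}}$ denotes the (unique, when it exists) $X\in A\{2\}$ with $\mathcal{R}(X)=\mathcal{T}$ and $\mathcal{N}(X)=\mathcal{S}$. *)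

(* Defs.v *)
From HB Require Import structures.
From mathcomp Require Import all_boot all_order all_algebra.
From mathcomp Require Import sesquilinear spectral.

Set Implicit Arguments.
Unset Strict Implicit.
Unset Printing Implicit Defensive.

Import Order.TTheory GRing.Theory Num.Theory.
Local Open Scope ring_scope.
Local Open Scope sesquilinear_scope.

(* Column range {M x} and (right) null space {x | M x = 0}: the row-space and
   kernel operations of mxalgebra are about x M instead. *)
Definition mxrange (F : fieldType) (m n : nat) (M : 'M[F]_(m, n)) :
  {vspace 'cV[F]_m} := limg (linfun (mulmx M : 'cV[F]_n -> 'cV[F]_m)).

Definition mxnull (F : fieldType) (m n : nat) (M : 'M[F]_(m, n)) :
  {vspace 'cV[F]_n} := lker (linfun (mulmx M : 'cV[F]_n -> 'cV[F]_m)).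

Section RangeNull.
Variable F : fieldType.

Lemma mem_mxrange m n (M : 'M[F]_(m, n)) (y : 'cV[F]_m) :
  reflect (exists x : 'cV[F]_n, y = M *m x) (y \in mxrange M).
Proof.
apply: (iffP memv_imgP) => [[x _ ->]|[x ->]]; exists x;
  by rewrite ?memvf ?lfunE.
Qed.

Lemma mem_mxnull m n (M : 'M[F]_(m, n)) (x : 'cV[F]_n) :
  (x \in mxnull M) = (M *m x == 0).
Proof. by rewrite memv_ker lfunE. Qed.

Lemma mxrangeS m n p (A : 'M[F]_(m, n)) (B : 'M[F]_(m, p)) :
  (mxrange A <= mxrange B)%VS -> exists Z, A = B *m Z.
Proof.
move=> /subvP sAB.
have /submxP [Z /(congr1 trmx)] : (A^T <= B^T)%MS.
  apply/row_subP => i; rewrite -tr_col.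
  have /sAB/mem_mxrange [x ->] : col i A \in mxrange A.
    by apply/mem_mxrange; exists (delta_mx i 0); rewrite colE.
  by rewrite trmx_mul submxMl.
by rewrite trmx_mul !trmxK => ->; exists Z^T.
Qed.

Lemma mxrange_mul m n p (A : 'M[F]_(m, n)) (B : 'M[F]_(n, p)) :
  (mxrange (A *m B) <= mxrange A)%VS.
Proof.
apply/subvP => y /mem_mxrange [x ->]; apply/mem_mxrange.
by exists (B *m x); rewrite mulmxA.
Qed.

End RangeNull.

Section Index.
Variables (F : fieldType) (n : nat) (M : 'M[F]_n).

Lemma mxind_subproof : exists k : nat, \rank (M ^+ k) == \rank (M ^+ k.+1).
Proof.
case: (boolP [exists k : 'I_n.+1, \rank (M ^+ k) == \rank (M ^+ k.+1)]).
  by case/existsP => k Hk; exists k.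
rewrite negb_exists => /forallP H.
have Hle k : (k <= n.+1)%N -> (\rank (M ^+ k) + k <= n)%N.
  elim: k => [|k IH] lek; first by rewrite addn0 rank_leq_row.
  apply: leq_trans (IH (ltnW lek)); rewrite addnS ltn_add2r ltn_neqAle.
  rewrite eq_sym (H (Ordinal lek)) /= exprS.
  exact: mxrankM_maxr.
have := Hle n.+1 (leqnn _); by rewrite addnS ltnNge leq_addl.
Qed.

Definition mxind : nat := ex_minn mxind_subproof.

Lemma mxindP : \rank (M ^+ mxind) = \rank (M ^+ mxind.+1).
Proof. by rewrite /mxind; case: ex_minnP => k /eqP. Qed.

Lemma mxind_row : exists Z : 'M[F]_n, M ^+ mxind = Z *m M ^+ mxind.+1.
Proof.
apply/submxP; have /mxrank_leqif_sup : (M ^+ mxind.+1 <= M ^+ mxind)%MS.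
  by rewrite exprS submxMl.
by case=> _; rewrite -mxindP eqxx => <-.
Qed.

Lemma mxind_col : exists Y : 'M[F]_n, M ^+ mxind = M ^+ mxind.+1 *m Y.
Proof.
suff /submxP [Y /(congr1 trmx)] : ((M ^+ mxind)^T <= (M ^+ mxind.+1)^T)%MS.
  by rewrite trmx_mul !trmxK => {1}->; exists Y^T.
have /mxrank_leqif_sup : ((M ^+ mxind.+1)^T <= (M ^+ mxind)^T)%MS.
  by rewrite exprSr trmx_mul submxMl.
by case=> _; rewrite !mxrank_tr -mxindP eqxx => <-.
Qed.

Definition is_drazin (X : 'M[F]_n) : bool :=
  [&& X *m M *m X == X, M *m X == X *m M
    & X *m M ^+ mxind.+1 == M ^+ mxind].

Lemma drazin_exists : exists X, is_drazin X.
Proof.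
have [Z HZ] := mxind_row; have [Y HY] := mxind_col.
set k := mxind in HZ HY *.
have HZj j : Z ^+ j * M ^+ (k + j) = M ^+ k.
  elim: j => [|j IH]; first by rewrite expr0 mul1r addn0.
  rewrite addnS -addSn exprD [Z ^+ _]exprSr -mulrA [Z * _]mulrA -[Z * _]HZ.
  by rewrite -exprD.
have HYj j : M ^+ (k + j) * Y ^+ j = M ^+ k.
  elim: j => [|j IH]; first by rewrite expr0 mulr1 addn0.
  rewrite addnS -addSn addnC exprD [Y ^+ _]exprS -mulrA.
  by rewrite [M ^+ k.+1 * _]mulrA -[M ^+ k.+1 * Y]HY mulrA -exprD addnC.
have ZY j : Z ^+ j * M ^+ k = M ^+ k * Y ^+ j.
  by rewrite -{1}(HYj j) mulrA HZj.
pose X : 'M[F]_n := M ^+ k * Y ^+ k.+1.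
have XE : X = Z ^+ k.+1 * M ^+ k by rewrite ZY.
have MX : M * X = M ^+ k * Y ^+ k.
  by rewrite /X mulrA -exprS [Y ^+ _]exprS mulrA -[M ^+ k.+1 * Y]HY.
have XM : X * M = M ^+ k * Y ^+ k.
  by rewrite XE -mulrA -exprSr [Z ^+ _]exprSr -mulrA -[Z * _]HZ ZY.
have XMk : X * M ^+ k.+1 = M ^+ k.
  by rewrite XE -mulrA -exprD HZj.
exists X; apply/and3P; split; apply/eqP.
- rewrite -[LHS]/(X * M * X) -mulrA /X (mulrA M) -exprS mulrA.
  by rewrite -[_ * _ * M ^+ k.+1]/(X * _) XMk.
- by rewrite -[LHS]/(M * X) -[RHS]/(X * M) MX XM.
- exact: XMk.
Qed.

Definition drazin : 'M[F]_n := xchoose drazin_exists.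

Lemma drazinP : is_drazin drazin. Proof. exact: xchooseP. Qed.

Lemma drazin_unique X Y : is_drazin X -> is_drazin Y -> X = Y.
Proof.
suff H U V : is_drazin U -> is_drazin V ->
    U = U *m M *m V /\ V = U *m M *m V.
  by move=> HX HY; have [E1 E2] := H _ _ HX HY; rewrite [LHS]E1.
move=> /and3P [/eqP U1 /eqP U2 /eqP U3] /and3P [/eqP V1 /eqP V2 /eqP V3].
set k := mxind in U3 V3.
have UE j : U = U ^+ j.+1 * M ^+ j.
  elim: j => [|j IH]; first by rewrite expr0 mulr1 expr1.
  rewrite [in RHS]exprS [M ^+ _]exprSr mulrA -[U * _ * _]mulrA -IH.
  by rewrite -mulrA -[U * M]U2 mulrA -[RHS]/(U *m M *m U) U1.
have VE j : V = M ^+ j * V ^+ j.+1.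
  elim: j => [|j IH]; first by rewrite expr0 mul1r expr1.
  rewrite [V ^+ _]exprSr [M ^+ _]exprS -!mulrA [M ^+ j * _]mulrA -IH.
  by rewrite mulrA -[RHS]/(M *m V *m V) V2 V1.
have V4 : M ^+ k.+1 * V = M ^+ k.
  have -> : M ^+ k.+1 * V = V * M ^+ k.+1; last exact: V3.
  by apply/esym/commrX/esym.
have UM : U ^+ k.+1 * M ^+ k.+1 = U * M by rewrite [M ^+ _]exprSr mulrA -UE.
have MV : M ^+ k.+1 * V ^+ k.+1 = M * V by rewrite [M ^+ _]exprS -mulrA -VE.
split.
- by rewrite -[RHS]/(U * M * V) -UM -mulrA V4 -UE.
- by rewrite -[RHS]/(U * M * V) -mulrA -MV mulrA -[U * _]/(U *m _) U3 -VE.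
Qed.

End Index.

Section MoorePenrose.
Variable C : numClosedFieldType.

Lemma trmxC_mul m n p (A : 'M[C]_(m, n)) (B : 'M[C]_(n, p)) :
  (A *m B)^t* = B^t* *m A^t*.
Proof. by rewrite trmx_mul map_mxM. Qed.

Lemma trmxC_inv n (A : 'M[C]_n) : (invmx A)^t* = invmx (A^t*).
Proof. by rewrite trmx_inv map_invmx. Qed.

Lemma mul_trmxC_eq0 m n (A : 'M[C]_(m, n)) : A *m A^t* = 0 -> A = 0.
Proof.
move=> A0; apply/matrixP => i j; rewrite [RHS]mxE.
have /matrixP/(_ i i) := A0; rewrite !mxE => /eqP.
rewrite psumr_eq0 => [/allP/(_ j)|l _]; rewrite !mxE ?mul_conjC_ge0 //.
by rewrite mem_index_enum mul_conjC_eq0 => /(_ isT)/eqP.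
Qed.

Lemma gram_unit m n (A : 'M[C]_(m, n)) :
  row_free A -> A *m A^t* \in unitmx.
Proof.
move=> fA; rewrite -row_free_unit; apply: inj_row_free => v v0.
apply/eqP; rewrite -(mulmx_free_eq0 _ fA); apply/eqP/mul_trmxC_eq0.
by rewrite trmxC_mul mulmxA -(mulmxA v) v0 mul0mx.
Qed.

Definition is_mpinv m n (A : 'M[C]_(m, n)) (X : 'M[C]_(n, m)) : bool :=
  [&& A *m X *m A == A, X *m A *m X == X,
      (A *m X)^t* == A *m X & (X *m A)^t* == X *m A].

Lemma mpinv_exists m n (A : 'M[C]_(m, n)) : exists X, is_mpinv A X.
Proof.
have [r [L [R [uL uR AE]]]] : exists r (L : 'M[C]_(m, r)) (R : 'M[C]_(r, n)),
    [/\ L^t* *m L \in unitmx, R *m R^t* \in unitmx & A = L *m R].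
  exists (\rank A), (col_base A), (row_base A); split.
  - have := @gram_unit _ _ ((col_base A)^t*); rewrite trmxCK; apply.
    by rewrite /row_free mxrank_map mxrank_tr; exact: col_base_full.
  - by rewrite gram_unit ?row_base_free.
  - by rewrite mulmx_base.
pose IR := invmx (R *m R^t*); pose IL := invmx (L^t* *m L).
pose X := R^t* *m IR *m IL *m L^t*.
have AX : A *m X = L *m IL *m L^t*.
  by rewrite AE /X !mulmxA -(mulmxA L R) -(mulmxA L (R *m _)) mulmxV // mulmx1.
have XA : X *m A = R^t* *m IR *m R.
  by rewrite AE /X !mulmxA -(mulmxA _ (L^t*)) -(mulmxA _ IL) mulVmx // mulmx1.
exists X; apply/and4P; split; apply/eqP.
- by rewrite AX AE !mulmxA -(mulmxA _ (L^t*)) -(mulmxA _ IL) mulVmx // mulmx1.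
- rewrite XA /X !mulmxA -(mulmxA _ R).
  by rewrite -(mulmxA _ (R *m _)) mulmxV // mulmx1.
- by rewrite AX !trmxC_mul trmxCK trmxC_inv trmxC_mul trmxCK mulmxA.
- by rewrite XA !trmxC_mul trmxCK trmxC_inv trmxC_mul trmxCK mulmxA.
Qed.

Definition mpinv m n (A : 'M[C]_(m, n)) : 'M[C]_(n, m) :=
  xchoose (mpinv_exists A).

Lemma mpinvP m n (A : 'M[C]_(m, n)) : is_mpinv A (mpinv A).
Proof. exact: xchooseP. Qed.

Lemma mpinv_unique m n (A : 'M[C]_(m, n)) X Y :
  is_mpinv A X -> is_mpinv A Y -> X = Y.
Proof.
move=> /and4P [/eqP X1 /eqP X2 /eqP X3 /eqP X4].
move=> /and4P [/eqP Y1 /eqP Y2 /eqP Y3 /eqP Y4].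
have XAY : A *m X = A *m Y.
  by rewrite -X3 -{1}Y1 -(mulmxA (A *m Y)) trmxC_mul X3 Y3 mulmxA X1.
have YAX : X *m A = Y *m A.
  by rewrite -X4 -{1}Y1 -(mulmxA A) mulmxA trmxC_mul X4 Y4 -mulmxA (mulmxA A) X1.
by rewrite -X2 -mulmxA XAY mulmxA YAX Y2.
Qed.

Definition is_coreEP n (M X : 'M[C]_n) : bool :=
  [&& X *m M *m X == X, mxrange X == mxrange (M ^+ mxind M)
    & mxrange (X^t*) == mxrange (M ^+ mxind M)].

Lemma coreEP_exists n (M : 'M[C]_n) : exists X, is_coreEP M X.
Proof.
have /and3P [/eqP D1 /eqP D2 /eqP D3] := drazinP M.
set D := drazin M in D1 D2 D3; set k := mxind M in D3.
pose Q := M ^+ k; pose G := mpinv Q; pose P := Q *m G.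
have /and4P [/eqP G1 _ /eqP G3 _] := mpinvP Q.
rewrite -/G in G1 G3; rewrite -/P in G1 G3.
have PP : P *m P = P by rewrite {2}/P mulmxA G1.
have DQ : D *m Q = Q *m D.
  by apply/esym/commr_sym; apply: commrX; apply/esym.
have MDQ : M *m (D *m Q) = Q by rewrite mulmxA D2 -mulmxA -[M *m Q]exprS.
have MDP : M *m (D *m P) = P by rewrite {1}/P (mulmxA D) mulmxA MDQ.
pose X := D *m P; exists X; rewrite /is_coreEP -/k -/Q.
apply/and3P; split; rewrite ?eqEsubv.
- by rewrite -(mulmxA X) MDP /X -mulmxA PP.
- apply/andP; split.
    by rewrite /X /P mulmxA DQ -mulmxA mxrange_mul.
  have -> : Q = X *m (M *m Q); last exact: mxrange_mul.
  have -> : M *m Q = Q *m M by rewrite -[LHS]exprS exprSr.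
  by rewrite /X -mulmxA (mulmxA P) G1 -[Q *m M]exprSr D3.
- apply/andP; split.
    by rewrite /X trmxC_mul G3 /P -mulmxA mxrange_mul.
  have -> : Q = X^t* *m (M^t* *m Q); last exact: mxrange_mul.
  by rewrite mulmxA -trmxC_mul MDP G3 G1.
Qed.

Definition coreEP n (M : 'M[C]_n) : 'M[C]_n := xchoose (coreEP_exists M).

Lemma coreEPP n (M : 'M[C]_n) : is_coreEP M (coreEP M).
Proof. exact: xchooseP. Qed.

Lemma coreEP_unique n (M X Y : 'M[C]_n) :
  is_coreEP M X -> is_coreEP M Y -> X = Y.
Proof.
move=> /and3P [/eqP X1 /eqP X2 /eqP X3] /and3P [/eqP Y1 /eqP Y2 /eqP Y3].
have [|T YE] := @mxrangeS _ _ _ _ Y X; first by rewrite X2 Y2.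
have [|S] := @mxrangeS _ _ _ _ (X^t*) (Y^t*); first by rewrite X3 Y3.
move=> /(congr1 (fun Z => Z^t*)); rewrite trmxC_mul !trmxCK => XE.
have <- : X *m M *m Y = Y by rewrite YE mulmxA X1.
by rewrite {2}XE -!mulmxA (mulmxA Y) Y1 -XE.
Qed.

End MoorePenrose.

Section OuterInverse.
Variables (F : fieldType) (q n : nat) (A : 'M[F]_(q, n)).

Definition outer_inverse : pred 'M[F]_(n, q) := [pred X | X *m A *m X == X].

(* X = A^(2)_{T,S}: X exists with the required properties and is the only
   matrix having them. *)
Definition is_outer_inverse_TS (T : {vspace 'cV[F]_n}) (S : {vspace 'cV[F]_q})
    (X : 'M[F]_(n, q)) : Prop :=
  unique (fun Y => [/\ Y \in outer_inverse, mxrange Y = T & mxnull Y = S]) X.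

End OuterInverse.

Section Weighted.
Variables (C : numClosedFieldType) (q n : nat).
Implicit Types (A X Y : 'M[C]_(q, n)) (W : 'M[C]_(n, q)).

Definition wmul W X Y : 'M[C]_(q, n) := X *m W *m Y.

(* l-fold product X * (X * ... * X), for l > 0 only; the value 0 at l = 0 is a
   dummy. *)
Definition wexp W X (l : nat) : 'M[C]_(q, n) := iterop l (wmul W) X 0.

Definition wdrazin A W : 'M[C]_(q, n) := A *m drazin (W *m A) ^+ 2.

Definition wcoreEP A W : 'M[C]_(q, n) := A *m coreEP (W *m A) ^+ 2.

Definition wmwg (m : nat) A W : 'M[C]_(q, n) :=
  wexp W (wcoreEP A W) m.+1 *m W *m wexp W A m.

Definition wmwgmp (m : nat) A W : 'M[C]_(n, q) :=
  W *m wmwg m A W *m W *m A *m mpinv A.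

End Weighted.

(* Main.v *)
(* Put M = WA and E = the core-EP inverse of M. Since M E^2 = E and E M E = E,
   the weighted powers telescope and the W-m-WGMP inverse collapses to
   Z = E^(m+1) M^(m+1) A^dag. As M A^dag A = M, Z is an outer inverse of A
   with the range of E, which is that of M^k; and E^(m+1), A E^2 and (M^k)^*
   all have the null space of E. *)
Require Import Defs.
From mathcomp Require Import all_boot all_order all_algebra.
From mathcomp Require Import sesquilinear spectral complex reals.

Import Order.TTheory GRing.Theory Num.Theory.
Local Open Scope ring_scope.
Local Open Scope complex_scope.
Local Open Scope sesquilinear_scope.

Set Implicit Arguments.
Unset Strict Implicit.

(** * Cancelling powers of two ring elements *)

Section PowerCancellation.
Variables (S : pzRingType) (x e : S).

Lemma mulr_exp_cancel i : x * e ^+ 2 = e -> x ^+ i * e ^+ i.+1 = e.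
Proof.
move=> xe2; elim: i => [|i IH]; first by rewrite mul1r.
rewrite exprSr -mulrA -addn2 addnC exprD (mulrA x) xe2 -exprS.
exact: IH.
Qed.

(** Each [e] on the right removes one [x], down to exponent [j]. This serves a matrix with its
    Drazin inverse, and also the powers of the core-EP inverse. *)
Lemma exprD_cancel i j :
  x ^+ j.+1 * e = x ^+ j -> x ^+ (j + i) * e ^+ i = x ^+ j.
Proof.
move=> xje; elim: i => [|i IH]; first by rewrite addn0 mulr1.
rewrite addnS -addSn addnC exprD (exprS e) -mulrA (mulrA _ e) xje.
by rewrite mulrA -exprD addnC.
Qed.

End PowerCancellation.

(** * Ranges and null spaces compared through factorizations *)

Section RangeNullFactor.
Variable F : fieldType.

Lemma eq_mxrange m n p (A : 'M[F]_(m, n)) (B : 'M[F]_(m, p)) U V :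
  A = B *m U -> B = A *m V -> mxrange A = mxrange B.
Proof.
move=> AE BE; apply/eqP; rewrite eqEsubv; apply/andP; split.
  by rewrite AE mxrange_mul.
by rewrite BE mxrange_mul.
Qed.

Lemma eq_mxrange_rank m n p (A : 'M[F]_(m, n)) (B : 'M[F]_(m, p)) :
  mxrange A = mxrange B -> \rank A = \rank B.
Proof.
move=> eqAB; apply/eqP; rewrite eqn_leq; apply/andP; split.
  have [|U ->] := @mxrangeS _ _ _ _ A B; first by rewrite eqAB.
  exact: mxrankM_maxl.
have [|V ->] := @mxrangeS _ _ _ _ B A; first by rewrite eqAB.
exact: mxrankM_maxl.
Qed.

Lemma mxnull_mul m n p (A : 'M[F]_(m, n)) (B : 'M[F]_(n, p)) :
  (mxnull B <= mxnull (A *m B))%VS.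
Proof.
apply/subvP => x; rewrite !mem_mxnull -mulmxA => /eqP ->.
by rewrite mulmx0.
Qed.

Lemma eq_mxnull m n p (A : 'M[F]_(m, n)) (B : 'M[F]_(p, n)) U V :
  A = U *m B -> B = V *m A -> mxnull A = mxnull B.
Proof.
move=> AE BE; apply/eqP; rewrite eqEsubv; apply/andP; split.
  by rewrite BE mxnull_mul.
by rewrite AE mxnull_mul.
Qed.

(** The null space of [A *m Y] is the preimage under [Y] of that of [A]. *)
Lemma mxnull_mulr m n p r (A : 'M[F]_(m, n)) (B : 'M[F]_(p, n))
    (Y : 'M[F]_(n, r)) :
  mxnull A = mxnull B -> mxnull (A *m Y) = mxnull (B *m Y).
Proof.
move=> eqAB; apply/vspaceP => x.
by rewrite !mem_mxnull -!mulmxA -!mem_mxnull eqAB.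
Qed.

Lemma mxnullS_mul0 m n p r (A : 'M[F]_(m, n)) (B : 'M[F]_(p, n))
    (Y : 'M[F]_(n, r)) :
  (mxnull A <= mxnull B)%VS -> A *m Y = 0 -> B *m Y = 0.
Proof.
move=> /subvP sAB AY; apply/matrixP => i j.
have /sAB : col j Y \in mxnull A.
  by rewrite mem_mxnull colE mulmxA AY mul0mx.
rewrite mem_mxnull colE mulmxA -colE => /eqP/matrixP/(_ i 0).
by rewrite !mxE.
Qed.

(** For a competitor [Y], [Y A X = X] because [Y A] fixes the range of [Y], and [Y A X = Y] because
    the columns of [1 - A X] lie in the common null space. *)
Lemma outer_inverse_TS q n (A : 'M[F]_(q, n)) (X : 'M[F]_(n, q)) :
  X \in outer_inverse A -> is_outer_inverse_TS A (mxrange X) (mxnull X) X.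
Proof.
move=> X2; split=> // Y [Y2 rYX nYX].
move: X2 Y2; rewrite !inE => /eqP X2 /eqP Y2.
have [|U XE] := @mxrangeS _ _ _ _ X Y; first by rewrite rYX.
have YAX : Y *m A *m X = X by rewrite XE mulmxA Y2.
have : Y *m (1%:M - A *m X) = 0.
  apply: (@mxnullS_mul0 _ _ _ _ X); first by rewrite nYX.
  by rewrite mulmxBr mulmx1 mulmxA X2 subrr.
by rewrite mulmxBr mulmx1 mulmxA YAX => /eqP; rewrite subr_eq0 => /eqP.
Qed.

End RangeNullFactor.

(** * Ranges of the Drazin inverse and of high powers *)

Section Drazin.
Variables (F : fieldType) (n : nat) (M : 'M[F]_n).

Lemma mulmx_drazin_sqr : M *m drazin M ^+ 2 = drazin M.
Proof.
have /and3P [/eqP D1 /eqP D2 _] := drazinP M.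
by rewrite expr2 -[_ * _]/(_ *m _) mulmxA D2 D1.
Qed.

Lemma mxrange_drazin : mxrange (drazin M) = mxrange (M ^+ mxind M).
Proof.
have /and3P [_ _ /eqP D3] := drazinP M.
apply: eq_mxrange (esym D3).
exact/esym/mulr_exp_cancel/mulmx_drazin_sqr.
Qed.

(** Powers of the Drazin inverse undo the factors of [M] beyond the index. *)
Lemma mxrange_pow_ge k :
  (mxind M <= k)%N -> mxrange (M ^+ k) = mxrange (M ^+ mxind M).
Proof.
have /and3P [_ /eqP D2 /eqP D3] := drazinP M.
move=> /subnKC <-; apply: eq_mxrange; first exact: exprD.
apply/esym/exprD_cancel; rewrite -[RHS]D3.
exact/esym/commrX/esym.
Qed.

End Drazin.

(** * Powers, ranges and null spaces of the core-EP inverse *)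

Section CoreEP.
Variables (C : numClosedFieldType) (n : nat) (M : 'M[C]_n).
Local Notation E := (coreEP M).

(** Since [E M E = E], [M E] is idempotent; its range contains that of [E], so it fixes [E]. *)
Lemma mulmx_coreEP_sqr : M * E ^+ 2 = E.
Proof.
have /and3P [/eqP E1 /eqP E2 _] := coreEPP M.
have [|T ET] := @mxrangeS _ _ _ _ E (M ^+ mxind M); first by rewrite E2.
have [|U MU] := @mxrangeS _ _ _ _ (M ^+ mxind M) E; first by rewrite E2.
have /and3P [_ /eqP D2 /eqP D3] := drazinP M.
have [V EV] : exists V, E = M * E * V.
  (* With [k] the index and [D] the Drazin inverse, [E = M^k T = M M^k D T = M E U D T]. *)
  exists (U * (drazin M * T)); rewrite -mulrA (mulrA E) -[E * U]MU mulrA -exprS.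
  rewrite mulrA ET -[M ^+ _ *m T]/(M ^+ _ * T); congr (_ * _).
  by rewrite -[LHS]D3; apply/commrX/esym.
rewrite expr2 {2}EV -!mulrA (mulrA E M) (mulrA (E * M)) [E * M * E]E1.
by rewrite mulrA -EV.
Qed.

Lemma coreEP_mul_exp i : E * M * E ^+ i.+1 = E ^+ i.+1.
Proof.
have /and3P [/eqP E1 _ _] := coreEPP M.
by rewrite exprS mulrA -[E * M * E]/(E *m M *m E) E1.
Qed.

(** [M^(i+1) E^(i+1)] cancels to [M E], which [E M E = E] then absorbs. *)
Lemma coreEP_exp_mul_exp i : E ^+ i.+1 * M ^+ i.+1 * E ^+ i.+1 = E ^+ i.+1.
Proof.
rewrite -mulrA (exprS M) -[M * _ * _]mulrA.
rewrite (mulr_exp_cancel i mulmx_coreEP_sqr).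
have /and3P [/eqP E1 _ _] := coreEPP M.
by rewrite exprSr -!mulrA (mulrA E) -[E * M * E]/(E *m M *m E) E1.
Qed.

Lemma mxrange_coreEP_exp i : mxrange (E ^+ i.+1) = mxrange E.
Proof.
have /and3P [/eqP E1 /eqP E2 _] := coreEPP M.
have [|T ET] := @mxrangeS _ _ _ _ E (M ^+ mxind M); first by rewrite E2.
have [|U MU] := @mxrangeS _ _ _ _ (M ^+ mxind M) E; first by rewrite E2.
(* The range of [E] is that of a power of [M], hence [M]-invariant: [M E = E S] for some [S]. Then
   [E^2 S = E M E = E], so [S^i] brings [E^(i+1)] back to [E]. *)
have MES : M * E = E * (U * (M * T)).
  rewrite (mulrA E) -[E * U]MU ET -[M ^+ _ *m T]/(M ^+ _ * T).
  by rewrite mulrA -exprS exprSr mulrA.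
apply: (@eq_mxrange _ _ _ _ _ _ (E ^+ i) ((U * (M * T)) ^+ i)).
  exact: exprS.
apply/esym/(@exprD_cancel _ _ _ i 1).
by rewrite expr2 -mulrA -MES mulrA [LHS]E1.
Qed.

(** Conjugate transposition turns the condition on the range of [E^t*] into one on the null space of
    [E]. *)
Lemma mxnull_pow_ge k :
  (mxind M <= k)%N -> mxnull ((M ^+ k)^t* ) = mxnull E.
Proof.
move=> le_k; have /and3P [_ _ /eqP E3] := coreEPP M.
have rE : mxrange (E^t* ) = mxrange (M ^+ k) by rewrite mxrange_pow_ge.
have [|T ET] := @mxrangeS _ _ _ _ (E^t* ) (M ^+ k); first by rewrite rE.
have [|U MU] := @mxrangeS _ _ _ _ (M ^+ k) (E^t* ); first by rewrite rE.
apply: (@eq_mxnull _ _ _ _ _ _ (U^t* ) (T^t* )).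
  by rewrite MU trmxC_mul trmxCK.
by rewrite -trmxC_mul -ET trmxCK.
Qed.

Lemma mxnull_coreEP_exp i : mxnull (E ^+ i.+1) = mxnull E.
Proof.
apply: (@eq_mxnull _ _ _ _ _ _ (E ^+ i) (M ^+ i)); first by rewrite exprSr.
exact/esym/mulr_exp_cancel/mulmx_coreEP_sqr.
Qed.

End CoreEP.

(** * Weighted powers and the collapsed form of the inverse *)

Section WeightedPowers.
Variables (C : numClosedFieldType) (q n : nat).
Variables (A : 'M[C]_(q, n)) (W : 'M[C]_(n, q)).
Local Notation M := (W *m A).
Local Notation E := (coreEP M).

(** Moves W-products into the ring of square matrices, where powers can cancel. *)
Lemma wmul_mulmx (X Y : 'M[C]_n) :
  wmul W (A *m X) (A *m Y) = A *m (X *m M *m Y).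
Proof. by rewrite /wmul !mulmxA. Qed.

Lemma wexpS_id l : wexp W A l.+1 = A *m M ^+ l.
Proof.
rewrite /wexp iteropS; elim: l => [|l IH]; first by rewrite mulmx1.
by rewrite iterS IH -{1}[A]mulmx1 wmul_mulmx mul1mx -[M *m _]exprS.
Qed.

(** Each new factor contributes [E^2 M], and [E M E = E] leaves just one more [E]. *)
Lemma wexpS_wcoreEP l : wexp W (wcoreEP A W) l.+1 = A *m E ^+ l.+2.
Proof.
rewrite /wexp iteropS; elim: l => [|l IH] //.
rewrite iterS IH wmul_mulmx; congr (_ *m _).
rewrite -[_ *m _]/(E ^+ 2 * M * E ^+ l.+2) expr2.
by rewrite -!mulrA (mulrA E M) coreEP_mul_exp -exprS.
Qed.

Lemma wdrazinE : W *m wdrazin A W = drazin M.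
Proof. by rewrite mulmxA mulmx_drazin_sqr. Qed.

Lemma wmwgmpE m : (0 < m)%N ->
  wmwgmp m A W = E ^+ m.+1 *m M ^+ m.+1 *m mpinv A.
Proof.
(* Positivity keeps [wexp W A m] off its dummy value at 0; from here [m] is the original exponent
   minus one. *)
case: m => // m _; rewrite /wmwgmp /wmwg wexpS_wcoreEP wexpS_id.
congr (_ *m _).
transitivity (M * E ^+ m.+3 * (M * M ^+ m * M)).
  by rewrite -![_ * _]/(_ *m _) !mulmxA.
(* Splitting [E^2] off [E ^+ m.+3] lets the leading [M] cancel one [E]. *)
by rewrite -exprS -exprSr (exprD _ 2) mulrA mulmx_coreEP_sqr -exprS.
Qed.

(** A positive power of [M = W A] ends in [A], and [A A^dag A = A]. *)
Lemma mulmx_mpinvK p l (X : 'M[C]_(p, n)) :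
  X *m M ^+ l.+1 *m mpinv A *m A = X *m M ^+ l.+1.
Proof.
have /and4P [/eqP AGA _ _ _] := mpinvP A.
by rewrite exprSr -[_ * M]/(_ *m M) -!mulmxA (mulmxA A) AGA.
Qed.

Lemma wmwgmp_outer m : (0 < m)%N -> wmwgmp m A W \in outer_inverse A.
Proof.
move=> m_gt0; rewrite inE wmwgmpE //; apply/eqP.
rewrite mulmx_mpinvK !mulmxA; congr (_ *m _ *m _).
exact: coreEP_exp_mul_exp.
Qed.

Lemma mxrange_wmwgmp m :
  (0 < m)%N -> mxrange (wmwgmp m A W) = mxrange (M ^+ mxind M).
Proof.
move=> m_gt0; have /and3P [_ /eqP <- _] := coreEPP M.
(* The witness works because [Z A = E^(m+1) M^(m+1)], so [Z A E^(m+1) = E^(m+1)]. *)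
rewrite -(mxrange_coreEP_exp M m); apply: eq_mxrange (A *m E ^+ m.+1) _ _.
  by rewrite wmwgmpE // -mulmxA.
rewrite mulmxA wmwgmpE // mulmx_mpinvK.
exact/esym/coreEP_exp_mul_exp.
Qed.

(** [W] recovers [E] from the left: [W A E^2 = M E^2 = E]. *)
Lemma mxnull_wcoreEP : mxnull (wcoreEP A W) = mxnull E.
Proof.
apply: (@eq_mxnull _ _ _ _ _ _ (A *m E) W); first by rewrite -mulmxA.
by rewrite mulmxA; exact/esym/mulmx_coreEP_sqr.
Qed.

End WeightedPowers.

Theorem theorem3p4 (R : realType) (q n : nat)
    (A : 'M[R[i]]_(q, n)) (W : 'M[R[i]]_(n, q)) (m : nat) :
  W != 0 -> (0 < m)%N ->
  let k := maxn (mxind (A *m W)) (mxind (W *m A)) in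
  let Z := wmwgmp m A W in
  let WA := W *m A in
  [/\ Z \in outer_inverse A,
      \rank Z = \rank (W *m wdrazin A W) /\
      \rank (W *m wdrazin A W) = \rank (WA ^+ k),
      mxrange Z = mxrange (W *m wdrazin A W) /\
      mxrange (W *m wdrazin A W) = mxrange (WA ^+ k),
      mxnull Z = mxnull (wcoreEP A W *m WA ^+ m.+1 *m mpinv A) /\
      mxnull (wcoreEP A W *m WA ^+ m.+1 *m mpinv A)
        = mxnull ((WA ^+ k)^t* *m WA ^+ m.+1 *m mpinv A)
    & is_outer_inverse_TS A (mxrange (W *m wdrazin A W))
        (mxnull (wcoreEP A W *m WA ^+ m.+1 *m mpinv A)) Z /\
      is_outer_inverse_TS A (mxrange (WA ^+ k))
        (mxnull ((WA ^+ k)^t* *m WA ^+ m.+1 *m mpinv A)) Z].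
Proof.
move=> _ m_gt0 k Z WA.
have le_k : (mxind WA <= k)%N := leq_maxr _ _.
have rD : mxrange (W *m wdrazin A W) = mxrange (WA ^+ k).
  by rewrite wdrazinE mxrange_drazin (mxrange_pow_ge le_k).
have rZ : mxrange Z = mxrange (WA ^+ k).
  by rewrite (mxrange_pow_ge le_k); exact: mxrange_wmwgmp.
have nC : mxnull (wcoreEP A W *m WA ^+ m.+1 *m mpinv A)
    = mxnull ((WA ^+ k)^t* *m WA ^+ m.+1 *m mpinv A).
  (* Stripping the common right factors leaves two matrices with the null space of [E]. *)
  by do 2!apply: mxnull_mulr; rewrite mxnull_wcoreEP mxnull_pow_ge.
have nZ : mxnull Z = mxnull (wcoreEP A W *m WA ^+ m.+1 *m mpinv A).
  rewrite /Z (wmwgmpE A W m_gt0); do 2!apply: mxnull_mulr.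
  by rewrite mxnull_wcoreEP mxnull_coreEP_exp.
have Z2 : Z \in outer_inverse A := wmwgmp_outer A W m_gt0.
have ZTS := outer_inverse_TS Z2.
clearbody Z; split.
- exact: Z2.
- by split; apply: eq_mxrange_rank; rewrite ?rZ ?rD.
- by split; [exact: etrans rZ (esym rD) | exact: rD].
- by split; [exact: nZ | exact: nC].
(* Both pairs of subspaces become the range and null space of [Z] itself. *)
- by rewrite -nC rD -nZ -rZ; split; exact: ZTS.
Qed.
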